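(* Let $0<p<+\infty$ and let $L_p=L_p(\Omega,\mathcal{M},\mu)$ be over $\mathbb{R}$ or $\mathbb{C}$, and assume $L_p$ is infinite dimensional. Consider $S_{L_p}=\{f\in L_p:\|f\|=1\}$ with the kernel $k(f,g)=\|f-g\|$. Then $A(S_{L_p})=R(S_{L_p})=\{2^{1/p}\}$.
   Context: Here $\|f\|:=(\int_\Omega|f|^p\,d\mu)^{1/p}$ for all $0<p<\infty$ (functions equal a.e. identified); for $0<p<1$, $L_p$ is a complete metrisable topological vector space with metric $d(f,g)=\int_\Omega|f-g|^p\,d\mu$, and $S_{L_p}$ carries this topology. For a regular Borel probability measure $\nu$ on $S_{L_p}$, $U^\nu(f)=\int\|f-g\|\,d\nu(g)$ and $A(\nu):=[\inf_{S_{L_p}}U^\nu,\sup_{S_{L_p}}U^\nu]$. The average set $A(S_{L_p})$ is the intersection of $A(\nu)$ over all regular Borel probability measures $\nu$ concentrated on $S_{L_p}$, and the rendezvous set $R(S_{L_p})$ is the intersection of $A(\nu)$ over all $\nu=\frac1n\sum_{j=1}^n\delta_{w_j}$, $n\in\mathbb{N}$, $w_j\in S_{L_p}$. *)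

(* Defs.v *)
From HB Require Import structures.
From mathcomp Require Import all_boot all_order all_algebra.
From mathcomp Require Import all_classical all_reals all_analysis.
From mathcomp Require Import complex.
Set Implicit Arguments. Unset Strict Implicit. Unset Printing Implicit Defensive.
Import Order.TTheory GRing.Theory Num.Theory.
Local Open Scope classical_set_scope.
Local Open Scope ring_scope.
Import numFieldNormedType.Exports.

Section LpSphere.
Context {R : realType} {d : measure_display} {Omega : measurableType d}.
Variable mu : {measure set Omega -> \bar R}.
Variable p : R.
Variable K : numFieldType.
Variable absK : K -> R.
Variable measK : (Omega -> K) -> Prop.

Definition lp_enorm (f : Omega -> K) : \bar R :=
  Lnorm mu p%:E (fun x => (absK (f x))%:E).

Definition inLp (f : Omega -> K) : Prop :=
  measK f /\ (lp_enorm f < +oo)%E.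

Definition lp_norm (f : Omega -> K) : R := fine (lp_enorm f).

Definition lp_dist (f g : Omega -> K) : R := lp_norm (fun x => f x - g x).

Definition Lp_sphere : set (Omega -> K) :=
  [set f | inLp f /\ lp_norm f = 1].

Definition sphere_ball (f : Omega -> K) (r : R) : set (Omega -> K) :=
  [set g | Lp_sphere g /\ lp_dist f g < r].

Definition sphere_open (O : set (Omega -> K)) : Prop :=
  O `<=` Lp_sphere /\
  forall f, O f -> exists2 r : R, 0 < r & sphere_ball f r `<=` O.

Definition sphere_compact (C : set (Omega -> K)) : Prop :=
  C `<=` Lp_sphere /\
  forall (I : Type) (U : I -> set (Omega -> K)),
    (forall i, sphere_open (U i)) -> C `<=` \bigcup_i U i ->
    exists F : set I, finite_set F /\ C `<=` \bigcup_(i in F) U i.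

Local Notation BorelS := (g_sigma_algebraType sphere_open).

Definition regular_on_sphere (nu : probability BorelS R) : Prop :=
  nu (~` (Lp_sphere : set BorelS)) = 0%E /\
  forall B : set BorelS, measurable B -> B `<=` Lp_sphere ->
    nu B = ereal_sup [set nu C | C in [set C | sphere_compact C /\ C `<=` B]]
    /\
    nu B = ereal_inf [set nu O | O in [set O | sphere_open O /\ B `<=` O]].

Definition Upot (nu : probability BorelS R) (f : Omega -> K) : \bar R :=
  (\int[nu]_(g in (Lp_sphere : set BorelS)) (lp_dist f g)%:E)%E.

Definition average_set : set R :=
  [set r : R | forall nu : probability BorelS R, regular_on_sphere nu ->
     (ereal_inf [set Upot nu f | f in Lp_sphere] <= r%:E <=
      ereal_sup [set Upot nu f | f in Lp_sphere])%E].

(* R(S_{L_p}): same, over nu = (1/n) sum_j delta_{w_j}, w_j in S_{L_p}, for *)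
(* which U^nu(f) = (1/n) sum_j ||f - w_j||                                  *)
Definition Udisc (n : nat) (w : 'I_n -> Omega -> K) (f : Omega -> K) : R :=
  n%:R^-1 * \sum_(j < n) lp_dist f (w j).

Definition rendezvous_set : set R :=
  [set r : R | forall (n : nat) (w : 'I_n -> Omega -> K), (0 < n)%N ->
     (forall j, Lp_sphere (w j)) ->
     (ereal_inf [set (Udisc w f)%:E | f in Lp_sphere] <= r%:E <=
      ereal_sup [set (Udisc w f)%:E | f in Lp_sphere])%E].

Definition Lp_infinite_dimensional : Prop :=
  forall n : nat, exists f : 'I_n -> (Omega -> K),
    (forall i, inLp (f i)) /\
    forall c : 'I_n -> K,
      {ae mu, forall x, \sum_(i < n) c i * f i x = 0} -> forall i, c i = 0.

End LpSphere.

Definition absR (R : realType) (x : R) : R := `|x|.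
Definition measR (R : realType) d (Omega : measurableType d)
  (f : Omega -> R) : Prop := measurable_fun [set: Omega] f.

Definition absC (R : realType) (z : R[i]) : R :=
  Num.sqrt (complex.Re z ^+ 2 + complex.Im z ^+ 2).
Definition measC (R : realType) d (Omega : measurableType d)
  (f : Omega -> R[i]) : Prop :=
  measurable_fun [set: Omega] (fun x => complex.Re (f x)) /\
  measurable_fun [set: Omega] (fun x => complex.Im (f x)).

(* Main.v *)
(** An infinite-dimensional [L_p] carries, for every [n], pairwise disjoint sets
    [A_0, ..., A_(n-1)] of positive finite measure; let [w_j] be the normalised
    indicator of [A_j].  For [f] on the unit sphere put
    [a_j = \int_(A_j) |f|^p], so that [\sum_j a_j <= 1].  Splitting the integral
    over [A_j] and its complement gives [| ||f - w_j||^p - 2 | <= e + C a_j]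
    with [C] depending on [e] only, hence [(1/n) \sum_j ||f - w_j||] is within
    any prescribed error of [2^(1/p)], uniformly in [f], once [n] is large.
    Uniformity pins the rendezvous set down to [2^(1/p)]; averaging the potential
    of an arbitrary [nu] over the [w_j] and exchanging sum and integral shows that
    [2^(1/p)] lies in the average set; and the average set is contained in the
    rendezvous set because empirical measures are regular. *)
Require Import Defs.
From HB Require Import structures.
From mathcomp Require Import all_boot all_order all_algebra.
From mathcomp Require Import all_classical all_reals all_analysis.
From mathcomp Require Import complex ring lra measurable_realfun.
Import Order.TTheory GRing.Theory Num.Theory.
Import numFieldNormedType.Exports.
Local Open Scope classical_set_scope.
Local Open Scope ring_scope.

Set Implicit Arguments. Unset Strict Implicit. Unset Printing Implicit Defensive.

(** * Empirical measures *)

Section empirical_measure.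
Context {d : measure_display} {T : measurableType d} {R : realType}.
Variables (n : nat) (w : 'I_n.+1 -> T).

(** Having [n.+1] points makes the normalisation meaningful; [inord] adapts them to the
    natural-number indexing of [msum]. *)
Definition empirical : set T -> \bar R :=
  mscale (n.+1%:R^-1)%:nng (msum (fun k => \d_(w (inord k))) n.+1).

HB.instance Definition _ := Measure.on empirical.

Lemma empiricalE A : empirical A = (n.+1%:R^-1 * \sum_j \1_A (w j))%:E.
Proof.
rewrite /empirical /mscale /= EFinM /msum -sumEFin; congr (_ * _)%E.
by apply: eq_bigr => j _; rewrite inord_val.
Qed.

Let empirical_setT : empirical setT = 1%E.
Proof.
rewrite empiricalE (eq_bigr (fun=> 1)); last by move=> j _; rewrite indicE in_setT.
by rewrite sumr_const card_ord mulVf.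
Qed.

HB.instance Definition _ :=
  Measure_isProbability.Build _ _ _ empirical empirical_setT.

(** Stated for arbitrary sets, because regularity evaluates the measure at compact sets whose
    measurability is not established. *)
Lemma empirical_le (A B : set T) : (forall j, A (w j) -> B (w j)) ->
  (empirical A <= empirical B)%E.
Proof.
move=> AB; rewrite !empiricalE lee_fin ler_wpM2l ?invr_ge0//.
apply: ler_sum => j _; rewrite !indicE; case: (boolP (w j \in A)) => //.
by rewrite inE => /AB h; rewrite mem_set.
Qed.

Lemma integral_empirical D (f : T -> R) : measurable D ->
  measurable_fun D f -> (forall x, D x -> 0 <= f x) -> (forall j, D (w j)) ->
  (\int[empirical]_(x in D) (f x)%:E = (n.+1%:R^-1 * \sum_j f (w j))%:E)%E.
Proof.
move=> mD /measurable_EFinP mf f0 Dw.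
rewrite ge0_integral_mscale//.
rewrite ge0_integral_measure_sum//.
rewrite EFinM -sumEFin; congr (_ * _)%E.
apply: eq_bigr => j _; rewrite integral_dirac// inord_val.
by rewrite diracE mem_set// mul1e.
Qed.

End empirical_measure.

(** * Averages of extended reals *)

(** Serves to bound the infimum of a potential by an average of its values. Since that infimum is an
    extended real, the infinite cases are treated apart. *)
Lemma mean_le (R : realType) n (u : 'I_n -> \bar R) m (x : R) : (0 < n)%N ->
  (forall j, m <= u j)%E -> (\sum_j u j <= (n%:R * x)%:E)%E -> (m <= x%:E)%E.
Proof.
case: n u => // n u _ mu su.
have {su mu} : (\sum_(j < n.+1) m <= (n.+1%:R * x)%:E)%E.
  by apply: le_trans su; apply: lee_sum => j _; exact: mu.
case: m => [r| |_]; last by rewrite leNye.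
  rewrite sumEFin !lee_fin sumr_const card_ord -(mulr_natl r) ler_pM2l//.
rewrite big_ord_recl addye; last first.
  rewrite -ltNye; apply: (@lt_le_trans _ _ 0%E); first exact: ltNy0.
  by apply: sume_ge0 => j _.
by rewrite leye_eq.
Qed.

Lemma mean_ge (R : realType) n (u : 'I_n -> \bar R) m (x : R) : (0 < n)%N ->
  (forall j, u j <= m)%E -> ((n%:R * x)%:E <= \sum_j u j)%E -> (x%:E <= m)%E.
Proof.
case: n u => // n u _ mu su.
have {su mu} : ((n.+1%:R * x)%:E <= \sum_(j < n.+1) m)%E.
  by apply: le_trans su _; apply: lee_sum => j _; exact: mu.
case: m => [r|_|]; last by rewrite big_ord_recl addNye leeNy_eq.
  rewrite sumEFin !lee_fin sumr_const card_ord -(mulr_natl r) ler_pM2l//.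
by rewrite leey.
Qed.

(** * Inequalities for real powers *)

(** Choose [t] with [(1 + t) ^ p = 1 + e]. If [a <= t b], then [a + b <= (1 + t) b]; otherwise
    [b < a / t] and [a + b <= (1 + 1/t) a]. Convex and concave powers are thus handled alike. *)
Lemma powRD_le (R : realType) (p e : R) : 0 < p -> 0 < e ->
  exists2 C, 0 <= C & forall a b, 0 <= a -> 0 <= b ->
    (a + b) `^ p <= (1 + e) * b `^ p + C * a `^ p.
Proof.
move=> p0 e0.
have t1 : 1 < (1 + e) `^ p^-1.
  rewrite -[X in X < _](_ : 1 `^ p^-1 = 1); last by rewrite powR1.
  by apply: gt0_ltr_powR; rewrite ?invr_gt0 ?nnegrE//; lra.
have [t tE] : {t | t = (1 + e) `^ p^-1 - 1} by eexists.
have t0 : 0 < t by lra.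
have tp : (1 + t) `^ p = 1 + e.
  by rewrite tE addrC subrK -powRrM mulVf ?gt_eqF// powRr1; lra.
exists ((1 + t^-1) `^ p); first exact: powR_ge0.
have ti : 0 < t^-1 by rewrite invr_gt0.
move=> a b a0 b0; have [ab|ba] := leP a (t * b).
- apply: (@le_trans _ _ ((1 + e) * b `^ p)); last first.
    by rewrite lerDl mulr_ge0 ?powR_ge0.
  rewrite -tp -powRM//; last by lra.
  by apply: ge0_ler_powR => //; rewrite ?nnegrE; nra.
- apply: (@le_trans _ _ ((1 + t^-1) `^ p * a `^ p)); last first.
    by rewrite lerDr mulr_ge0 ?powR_ge0//; lra.
  rewrite -powRM//; last by lra.
  have : b <= t^-1 * a by rewrite mulrC ler_pdivlMr// mulrC ltW.
  move=> h; apply: ge0_ler_powR => //; rewrite ?nnegrE; nra.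
Qed.

(** Within some radius [r] of [c] continuity gives the error [e]; farther away the difference is at
    most [M ^ q + c ^ q], which [L |x - c|] absorbs once [L] is that number divided by [r]. A bound
    linear in [|x - c|] can be averaged. *)
Lemma powR_Lipschitz_approx (R : realType) (q c M e : R) :
  0 < q -> 0 < c -> 0 < e ->
  exists2 L, 0 <= L & forall x, 0 <= x <= M ->
    `|x `^ q - c `^ q| <= e + L * `|x - c|.
Proof.
move=> q0 c0 e0.
have cq : {for c, continuous (fun x => x `^ q)}.
  apply: differentiable_continuous; apply/derivable1_diffP.
  by apply: derivable_powR; rewrite in_itv/= c0.
move/cvgrPdist_le : cq => /(_ _ e0) /nbhs_ballP[r /= r0 cr].
exists ((M `^ q + c `^ q) / r).
  by rewrite divr_ge0 ?addr_ge0 ?powR_ge0// ltW.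
move=> x /andP[x0 xM]; have [xr|xr] := ltP `|c - x| r.
  rewrite distrC; apply: (le_trans (cr _ xr)).
  by rewrite lerDl mulr_ge0// divr_ge0 ?addr_ge0 ?powR_ge0// ltW.
apply: (@le_trans _ _ (M `^ q + c `^ q)).
  apply: le_trans (ler_normB _ _) _; rewrite !ger0_norm ?powR_ge0// lerD2r.
  by apply: ge0_ler_powR => //; [exact: ltW|rewrite nnegrE (le_trans x0)].
apply: (@le_trans _ _ ((M `^ q + c `^ q) / r * `|x - c|)); last by rewrite lerDr ltW.
rewrite -mulrA ler_peMr ?addr_ge0 ?powR_ge0// mulrC ler_pdivlMr// mul1r.
by rewrite distrC.
Qed.

(** The choice of constants behind the openness of balls: each of the two error terms uses up at
    most half of the gap [t]. *)
Lemma perturbation_lt (R : realFieldType) (m t C D : R) :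
  0 <= m -> 0 < t -> 0 <= C -> D < t / (2 * (C + 1)) ->
  (1 + t / (2 * (m + 1))) * m + C * D < m + t.
Proof.
move=> m0 t0 C0 Dt.
have h1 : t / (2 * (m + 1)) * m <= t / 2.
  by rewrite mulrAC ler_pdivrMr ?mulr_gt0 ?ltr_wpDl//; nra.
have h2 : C * D < t / 2.
  apply: (@le_lt_trans _ _ (C * (t / (2 * (C + 1))))).
    by rewrite ler_wpM2l// ltW.
  by rewrite mulrA ltr_pdivrMr ?mulr_gt0 ?ltr_wpDl//; nra.
by rewrite mulrDl mul1r; lra.
Qed.

(** To be read with [a], [b] the integrals of [|f|^p] on [A] and off [A], and [c] that of
    [|f - w|^p] on [A], where [w] is a unit vector supported in [A]. Then [c + b] is the p-th power
    of the distance, and [c] is close to 1. *)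
Lemma dist_two_of_parts (R : realFieldType) (a b c e C : R) :
  0 <= e -> 0 <= C -> a + b = 1 -> 0 <= a -> 0 <= c ->
  1 <= (1 + e) * c + C * a -> c <= (1 + e) * 1 + C * a ->
  `|c + b - 2| <= e + (1 + C) * a.
Proof.
move=> e0 C0 ab a0 c0 h1 h2.
have Ca : 0 <= C * a by rewrite mulr_ge0.
rewrite ler_norml; apply/andP; split; last by lra.
have [c1|c1] := leP 1 c; first by lra.
have : e * c <= e by rewrite ler_piMr// ltW.
lra.
Qed.

(** * Atoms and measurable functions on them *)

Section atoms.
Context {R : realType} {d : measure_display} {T : measurableType d}.
Variable mu : {measure set T -> \bar R}.

Definition is_atom (A : set T) :=
  [/\ measurable A, (0 < mu A)%E &
   forall B, measurable B -> B `<=` A -> mu B = 0%E \/ mu (A `\` B) = 0%E].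

(* Deleting from A the null half of each splitting {f < q}, {f >= q} with q
   rational leaves a conull subset of A on which f is constant. *)
Lemma atom_ae_cst (A : set T) (f : T -> R) : is_atom A ->
  measurable_fun setT f -> exists c, {ae mu, forall x, A x -> f x = c}.
Proof.
move=> [mA A0 Aatom] mf.
(* An enumeration of the rationals, with value 0 at the numbers that encode none. *)
pose q (k : nat) : R := ratr (odflt 0%Q (unpickle k)).
pose B k := A `&` [set x | f x < q k].
have mB k : measurable (B k).
  rewrite /B; apply: measurableI => //.
  rewrite (_ : [set x | _] = f @^-1` `]-oo, q k[%classic); last first.
    by apply/seteqP; split=> x /=; rewrite in_itv.
  by rewrite -[X in measurable X]setTI; exact: mf.
have BA k : B k `<=` A by move=> x [].
have BAD k : A `\` (A `\` B k) = B k by rewrite setDD setIC setIidl.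
have /choice[N NP] k : exists N : set T,
    mu.-negligible N /\ (N = B k \/ N = A `\` B k).
  case: (Aatom _ (mB k) (BA k)) => h; [exists (B k)|exists (A `\` B k)]; split.
  - exact/negligibleP.
  - by left.
  - by apply/negligibleP => //; exact: measurableD.
  - by right.
have Nneg : mu.-negligible (\bigcup_k N k).
  by apply: negligible_bigcup => k; case: (NP k).
have mN k : measurable (N k).
  by have [_ [->|->]] := NP k => //; exact: measurableD.
have mNU : measurable (\bigcup_k N k) by exact: bigcup_measurable.
have [x0 [Ax0 Nx0]] : (A `\` \bigcup_k N k) !=set0.
  apply/set0P/eqP => h; move: A0; rewrite (_ : mu A = 0%E) ?ltxx//.
  apply/negligibleP => //; apply: negligibleS Nneg.
  by rewrite -setD_eq0.
exists (f x0).
rewrite /almost_everywhere /=; apply: negligibleS Nneg => x /=.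
move=> /not_implyP[Ax fx]; apply: contrapT => Nx; apply: fx.
have same k : (f x < q k) = (f x0 < q k).
  have notin y : ~ (\bigcup_k N k) y -> ~ N k y by move=> + Ny; apply; exists k.
  have := notin _ Nx; have := notin _ Nx0.
  have [_ [->|->]] := NP k; rewrite /B /= => h1 h2.
    apply/idP/idP => h; exfalso; [exact: h2|exact: h1].
  have {}h1 : f x0 < q k by apply: contrapT => ?; apply: h1; split=> // -[].
  have {}h2 : f x < q k by apply: contrapT => ?; apply: h2; split=> // -[].
  by rewrite h1 h2.
have qE r : q (pickle r) = ratr r by rewrite /q pickleK.
apply/eqP; rewrite eq_le; apply/andP; split; rewrite leNgt; apply/negP => lt.
- have [r] := rat_in_itvoo lt; rewrite in_itv/= => /andP[r1 r2].
  have := same (pickle r); rewrite qE r1 => /esym.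
  by rewrite ltNge (ltW r2).
- have [r] := rat_in_itvoo lt; rewrite in_itv/= => /andP[r1 r2].
  have := same (pickle r); rewrite qE r1.
  by rewrite ltNge (ltW r2).
Qed.

End atoms.
(* A scalar field seen through real coordinates [re] and [im]; the pair
   ([id], [0]) makes the real field an instance. *)
Record planar (R : realType) (d : measure_display) (Omega : measurableType d)
    (K : numFieldType) (absK : K -> R) (measK : (Omega -> K) -> Prop)
    (re im : K -> R) (ofR : R -> K) : Prop := Planar {
  planar_reB : forall x y, re (x - y) = re x - re y ;
  planar_imB : forall x y, im (x - y) = im x - im y ;
  planar_inj : forall x y, re x = re y -> im x = im y -> x = y ;
  planar_re : forall r, re (ofR r) = r ;
  planar_im : forall r, im (ofR r) = 0 ;
  planar_abs : forall x, absK x = Num.sqrt (re x ^+ 2 + im x ^+ 2) ;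
  planar_meas : forall f, measK f <->
    measurable_fun setT (re \o f) /\ measurable_fun setT (im \o f) }.

(** * Modulus and measurability in real coordinates *)

Section scalars.
Context {R : realType} {d : measure_display} {Omega : measurableType d}.
Context {mu : {measure set Omega -> \bar R}} {p : R} {K : numFieldType}.
Context {absK : K -> R} {measK : (Omega -> K) -> Prop}.
Context {re im : K -> R} {ofR : R -> K}.
Hypothesis pl : planar absK measK re im ofR.
Hypothesis p0 : 0 < p.

Let re0 : re 0 = 0. Proof. by rewrite -(subrr 0) (planar_reB pl) subrr. Qed.
Let im0 : im 0 = 0. Proof. by rewrite -(subrr 0) (planar_imB pl) subrr. Qed.

Lemma absK_ge0 x : 0 <= absK x.
Proof. by rewrite (planar_abs pl) sqrtr_ge0. Qed.

Lemma absK0 : absK 0 = 0.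
Proof. by rewrite (planar_abs pl) re0 im0 expr0n addr0 sqrtr0. Qed.

Lemma absK_eq0 x : absK x = 0 -> x = 0.
Proof.
move/eqP; rewrite (planar_abs pl) sqrtr_eq0 => h.
have hr := sqr_ge0 (re x); have hi := sqr_ge0 (im x).
apply: (planar_inj pl).
  by apply/eqP; rewrite re0 -sqrf_eq0; apply/eqP; lra.
by apply/eqP; rewrite im0 -sqrf_eq0; apply/eqP; lra.
Qed.

Lemma absK_ofR r : absK (ofR r) = `|r|.
Proof.
by rewrite (planar_abs pl) (planar_re pl) (planar_im pl) expr0n addr0 sqrtr_sqr.
Qed.

Lemma absKBC x y : absK (x - y) = absK (y - x).
Proof.
rewrite !(planar_abs pl) !(planar_reB pl) !(planar_imB pl).
by rewrite -(sqrrN (re x - _)) -(sqrrN (im x - _)) !opprB.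
Qed.

Lemma absKB_le x y z : absK (x - z) <= absK (x - y) + absK (y - z).
Proof.
rewrite !(planar_abs pl) !(planar_reB pl) !(planar_imB pl).
have -> : re x - re z = (re x - re y) + (re y - re z) by ring.
have -> : im x - im z = (im x - im y) + (im y - im z) by ring.
move: (re x - re y) (im x - im y) (re y - re z) (im y - im z) => a b u v.
have s1 := sqrtr_ge0 (a ^+ 2 + b ^+ 2); have s2 := sqrtr_ge0 (u ^+ 2 + v ^+ 2).
rewrite -ler_sqr ?nnegrE ?addr_ge0 ?sqrtr_ge0//.
rewrite sqr_sqrtr ?addr_ge0 ?sqr_ge0// [X in _ <= X]sqrrD !sqr_sqrtr ?addr_ge0 ?sqr_ge0//.
rewrite -sqrtrM ?addr_ge0 ?sqr_ge0//.
(* Cauchy-Schwarz in the plane; the defect of the squares is [(a v - b u)^2]. *)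
have : a * u + b * v <= Num.sqrt ((a ^+ 2 + b ^+ 2) * (u ^+ 2 + v ^+ 2)).
  apply: le_trans (ler_norm _) _; rewrite -sqrtr_sqr ler_wsqrtr//.
  have := sqr_ge0 (a * v - b * u); nra.
rewrite !sqrrD; lra.
Qed.

Lemma measurable_absK f : measK f -> measurable_fun setT (absK \o f).
Proof.
move=> /(planar_meas pl)[mr mi].
rewrite (_ : absK \o f = fun x => ((re \o f) x ^+ 2 + (im \o f) x ^+ 2) `^ 2^-1).
  apply: (measurableT_comp (measurable_powR _)).
  by apply: measurable_funD; apply: measurable_funX.
apply/funext => x /=.
by rewrite powR12_sqrt ?addr_ge0 ?sqr_ge0// (planar_abs pl).
Qed.

Lemma measKB f g : measK f -> measK g -> measK (fun x => f x - g x).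
Proof.
move=> /(planar_meas pl)[fr fi] /(planar_meas pl)[gr gi].
apply/(planar_meas pl); split.
  rewrite (_ : re \o _ = (re \o f) \- (re \o g)); first exact: measurable_funB.
  by apply/funext => x /=; rewrite (planar_reB pl).
rewrite (_ : im \o _ = (im \o f) \- (im \o g)); first exact: measurable_funB.
by apply/funext => x /=; rewrite (planar_imB pl).
Qed.

Lemma measK_indic (A : set Omega) (r : R) : measurable A ->
  measK (fun x => ofR (r * \1_A x)).
Proof.
move=> mA; apply/(planar_meas pl); split.
  rewrite (_ : re \o _ = (fun x => r * \1_A x)).
    by apply: measurable_funM => //; exact: measurable_indic.
  by apply/funext => x /=; rewrite (planar_re pl).
rewrite (_ : im \o _ = cst 0)//.
by apply/funext => x /=; rewrite (planar_im pl).
Qed.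

Lemma atom_ae_cstK (A : set Omega) f : is_atom mu A -> measK f ->
  exists c, {ae mu, forall x, A x -> f x = c}.
Proof.
move=> atA /(planar_meas pl)[fr fi].
have [cr hr] := atom_ae_cst atA fr; have [ci hi] := atom_ae_cst atA fi.
have [[x0 [rx ix]]|nx] := pselect (exists x0, re (f x0) = cr /\ im (f x0) = ci).
  exists (f x0); apply: filterS2 hr hi => x h1 h2 Ax.
  by apply: (planar_inj pl); [rewrite rx; exact: h1|rewrite ix; exact: h2].
(* [planar] does not build a scalar from two given coordinates, so the constant above was a value of
   [f]. If no point has both coordinate values, almost no point lies in [A] and any constant will
   do. *)
exists 0; apply: filterS2 hr hi => x h1 h2 Ax.
by exfalso; apply: nx; exists x; split; [exact: h1|exact: h2].
Qed.

(** * The integral of the p-th power of the modulus *)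

Definition mass f A := (\int[mu]_(x in A) (absK (f x) `^ p)%:E)%E.

Lemma measurable_mass f A : measK f ->
  measurable_fun A (fun x => (absK (f x) `^ p)%:E).
Proof.
move=> mf; apply: measurable_funTS; apply/measurable_EFinP.
by apply: (measurableT_comp (measurable_powR p)); exact: measurable_absK.
Qed.

Lemma mass_ge0 f A : (0 <= mass f A)%E.
Proof. by apply: integral_ge0 => x _; rewrite lee_fin powR_ge0. Qed.

Lemma lp_enormE f : lp_enorm mu p absK f = (mass f setT `^ p^-1)%E.
Proof.
rewrite /lp_enorm unlock /mass.
rewrite (eq_integral (fun x => (absK (f x) `^ p)%:E))// => x _.
by rewrite /= ger0_norm ?absK_ge0.
Qed.

Lemma inLpE f : inLp mu p absK measK f <-> measK f /\ (mass f setT < +oo)%E.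
Proof.
rewrite /inLp lp_enormE; split => -[mf h]; split => //.
  by apply: lty_poweRy h; rewrite invr_neq0// gt_eqF.
exact: poweR_lty.
Qed.

Lemma lp_normE f : lp_norm mu p absK f = fine (mass f setT) `^ p^-1.
Proof. by rewrite /lp_norm lp_enormE fine_poweR. Qed.

Lemma Lp_sphereE f :
  Lp_sphere mu p absK measK f <-> measK f /\ mass f setT = 1%E.
Proof.
have pi0 : 0 < p^-1 by rewrite invr_gt0.
rewrite /Lp_sphere /=; split => [[/inLpE[mf fin]]|[mf m1]].
  rewrite lp_normE => h; split => //.
  have ffin : mass f setT \is a fin_num by rewrite ge0_fin_numE// mass_ge0.
  rewrite -(fineK ffin); congr EFin; apply: (powR_injective pi0).
  - by rewrite nnegrE fine_ge0// mass_ge0.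
  - by rewrite nnegrE.
  - by rewrite h powR1.
split; first by apply/inLpE; rewrite m1 ltry.
by rewrite lp_normE m1 /= powR1.
Qed.

(** * Disjoint sets of positive finite measure *)

(** By Markov's inequality each set where [|f|^p >= 1/(k+1)] has finite measure, so its part outside
    [A] is null by the maximality assumed of [A]. Countably many such parts cover the points outside
    [A] where [f] is nonzero. *)
Lemma ae_eq0_outside (A : set Omega) f : measurable A ->
  (forall B, measurable B -> (mu B < +oo)%E -> A `&` B = set0 -> mu B = 0%E) ->
  inLp mu p absK measK f -> {ae mu, forall x, ~ A x -> f x = 0}.
Proof.
move=> mA Amax /inLpE[mf fin].
pose g x := (absK (f x) `^ p)%:E.
have mg : measurable_fun setT g by exact: measurable_mass.
pose B (k : nat) := ([set: Omega] `&` [set x | ((k.+1%:R^-1)%:E <= `|g x|)%E]) `\` A.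
have mB1 k : measurable ([set: Omega] `&` [set x | ((k.+1%:R^-1)%:E <= `|g x|)%E]).
  by apply: emeasurable_fun_c_infty => //; exact: measurableT_comp.
have B0 k : mu.-negligible (B k).
  have mBk : measurable (B k) by exact: measurableD.
  apply/negligibleP => //; apply: Amax => //; last first.
    by rewrite /B setDE setIC -setIA [~` A `&` A]setIC setICr setI0.
  apply: (@le_lt_trans _ _
      (mu ([set: Omega] `&` [set x | ((k.+1%:R^-1)%:E <= `|g x|)%E]))).
    by apply: le_measure; rewrite ?inE//; exact: subDsetl.
  have k0 : (0 < k.+1%:R^-1 :> R) by rewrite invr_gt0 ltr0n.
  have := le_integral_abse mu measurableT mg k0.
  rewrite (_ : (\int[mu]_x `|g x|)%E = mass f setT); last first.
    by apply: eq_integral => x _; rewrite /g gee0_abs// lee_fin powR_ge0.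
  move=> h; rewrite ltNge; apply/negP; rewrite leye_eq => /eqP moo.
  by move: h; rewrite moo gt0_muley ?lte_fin// leye_eq => /eqP e; rewrite e in fin.
have := negligible_bigcup B0; apply: negligibleS => x /= /not_implyP[Ax fx].
have gx : 0 < absK (f x) `^ p.
  rewrite powR_gt0// lt_neqAle absK_ge0 andbT eq_sym.
  by apply/eqP => /absK_eq0.
have [k _ /(_ k (leqnn k)) kP] := near_infty_natSinv_lt (PosNum gx).
exists k => //; split => //; split => //=.
by rewrite lee_fin ger0_norm ?powR_ge0// ltW.
Qed.

(** Induction on [n]: either some [A i] splits into two sets of positive measure, or a further
    disjoint set of positive finite measure exists. If both fail, the [A i] are atoms, every
    function in L_p vanishes a.e. outside their union and is a.e. constant on each, so any [n + 1]
    such functions are dependent. *)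
Lemma exists_disjoint_sets n : Lp_infinite_dimensional mu p absK measK ->
  exists A : nat -> set Omega,
    (forall i, (i < n)%N -> [/\ measurable (A i), (0 < mu (A i))%E & (mu (A i) < +oo)%E]) /\
    (forall i j, (i < n)%N -> (j < n)%N -> i != j -> A i `&` A j = set0).
Proof.
move=> inf; elim: n => [|n [A [AP Adis]]]; first by exists (fun=> set0).
have [[i [B [ni mB BA B0 AB0]]]|nosplit] := pselect (exists i B,
    [/\ (i < n)%N, measurable B, B `<=` A i, mu B <> 0%E & mu (A i `\` B) <> 0%E]).
  have [mAi Ai0 Aioo] := AP _ ni.
  have mAB : measurable (A i `\` B) by exact: measurableD.
  (* One half of [A i] keeps the index [i], the other takes the new index [n]. *)
  pose A' k := if k == i then B else if k == n then A i `\` B else A k.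
  exists A'.
  have sub k : A' k `<=` (if k == n then A i else A k).
    rewrite /A'; have [->|_] := eqVneq k i; first by rewrite ltn_eqF.
    by have [_|_] := eqVneq k n => //; exact: subDsetl.
  split=> [k|k l].
    rewrite ltnS leq_eqVlt /A' => kn; have [_|ki] := eqVneq k i.
      split => //; first by rewrite lt_neqAle measure_ge0 andbT eq_sym; exact/eqP.
      by apply: le_lt_trans Aioo; apply: le_measure; rewrite ?inE.
    move: kn; have [_ _|_ /= /AP//] := eqVneq k n.
    split => //; first by rewrite lt_neqAle measure_ge0 andbT eq_sym; exact/eqP.
    by apply: le_lt_trans Aioo; apply: le_measure; rewrite ?inE//; exact: subDsetl.
  wlog : k l / (k < l)%N.
    move=> W kn ln kl; have [?|?|e] := ltngtP k l; first exact: W.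
      by rewrite setIC; apply: W; rewrite // eq_sym.
    by rewrite e eqxx in kl.
  move=> kl; rewrite !ltnS => kn ln kln.
  have {}kn : (k < n)%N by exact: leq_trans kl ln.
  have knE : (k == n) = false by rewrite ltn_eqF.
  move: ln; rewrite leq_eqVlt => /orP[/eqP ->|ln].
    have [->|ki] := eqVneq k i.
      by rewrite /A' eqxx gtn_eqF// eqxx setIDA setIC setDE -setIA setICr setI0.
    apply/seteqP; split => // x [/sub + /sub]; rewrite knE eqxx => Ak Ai.
    by rewrite -(Adis _ _ kn ni ki); split.
  apply/seteqP; split => // x [/sub + /sub]; rewrite knE ltn_eqF// => Ak Al.
  by rewrite -(Adis _ _ kn ln kln); split.
have [[B [mB Boo Bdis B0]]|noext] := pselect (exists B,
    [/\ measurable B, (mu B < +oo)%E,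
        forall i, (i < n)%N -> A i `&` B = set0 & mu B <> 0%E]).
  exists (fun k => if k == n then B else A k); split=> [k|k l].
    rewrite ltnS leq_eqVlt; have [_ _|_ /= /AP//] := eqVneq k n.
    by split => //; rewrite lt_neqAle measure_ge0 andbT eq_sym; exact/eqP.
  rewrite !ltnS [(k <= n)%N]leq_eqVlt [(l <= n)%N]leq_eqVlt.
  have [->|kn] := eqVneq k n; have [->|ln] := eqVneq l n => //=.
  - by move=> _ + _ => /Bdis; rewrite setIC.
  - by move=> + _ _ => /Bdis.
  - exact: Adis.
have atA (j : 'I_n) : is_atom mu (A j).
  have [mAj Aj0 _] := AP _ (ltn_ord j); split => // B mB BA.
  have [->|/eqP h1] := eqVneq (mu B) 0%E; first by left.
  have [->|/eqP h2] := eqVneq (mu (A j `\` B)) 0%E; first by right.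
  by exfalso; apply: nosplit; exists j, B.
have mUA : measurable (\big[setU/set0]_(j < n) A j).
  by apply: bigsetU_measurable => j _; have [] := AP _ (ltn_ord j).
have [f [fLp find]] := inf n.+1.
have out i : {ae mu, forall x, ~ (\big[setU/set0]_(j < n) A j) x -> f i x = 0}.
  apply: ae_eq0_outside (fLp i) => // B mB Boo AB.
  apply: contrapT => B0; apply: noext; exists B; split => // j jn.
  apply/seteqP; split => // x [Aj Bx]; rewrite -AB; split => //.
  by rewrite -bigcup_mkord; exists j.
have /choice[c cP] (ij : 'I_n.+1 * 'I_n) :
    exists c, {ae mu, forall x, A ij.2 x -> f ij.1 x = c}.
  by apply: atom_ae_cstK => //; have [] := fLp ij.1.
(* The matrix of a.e. constant values has more rows than columns; a nonzero vector of its left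
   kernel is a forbidden linear relation. *)
pose M := \matrix_(i < n.+1, j < n) c (i, j).
have : kermx M != 0.
  rewrite kermx_eq0 /row_free; apply/negP => /eqP rk.
  by have := rank_leq_col M; rewrite rk ltnn.
move=> /rowV0Pn[v /sub_kermxP vM /eqP v0]; apply: False_ind; apply: v0.
have v0 i : v ord0 i = 0.
  apply: (find (fun i => v ord0 i)).
  have /filter_forall out' := out; have /filter_forall cP' := cP.
  apply: filterS2 out' cP' => x o cx.
  have [Ux|nUx] := pselect ((\big[setU/set0]_(j < n) A j) x).
    move: Ux; rewrite -bigcup_mkord => -[j /= jn Ajx].
    have /matrixP/(_ ord0 (Ordinal jn)) := vM; rewrite !mxE => vj.
    rewrite -[RHS]vj; apply: eq_bigr => k _.
    by rewrite !mxE (cx (k, Ordinal jn)).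
  by rewrite big1// => k _; rewrite o// mulr0.
by apply/rowP => i; rewrite mxE v0.
Qed.

(** * Distances on the sphere *)

Lemma eq_mass f g A : (forall x, A x -> absK (f x) = absK (g x)) ->
  mass f A = mass g A.
Proof. by move=> fg; apply: eq_integral => x; rewrite inE => /fg ->. Qed.

Lemma mass_subC f g A : mass (fun x => f x - g x) A = mass (fun x => g x - f x) A.
Proof. by apply: eq_mass => x _; rewrite absKBC. Qed.

Lemma mass_setC f A : measurable A -> measK f ->
  mass f setT = (mass f A + mass f (~` A))%E.
Proof.
move=> mA mf; rewrite /mass -(setUv A) ge0_integral_setU//.
- exact: measurableC.
- by apply: measurable_mass.
- by move=> x _; rewrite lee_fin powR_ge0.
- by apply/disj_setPS => x [].
Qed.

Lemma mass_eq0 f A : (forall x, A x -> f x = 0) -> mass f A = 0%E.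
Proof.
by move=> f0; rewrite /mass integral0_eq// => x /f0 ->; rewrite absK0 powR0// gt_eqF.
Qed.

Lemma mass_fin_num f A : measurable A -> measK f -> (mass f setT < +oo)%E ->
  mass f A \is a fin_num.
Proof.
move=> mA mf; rewrite ge0_fin_numE ?mass_ge0//; apply: le_lt_trans.
apply: ge0_subset_integral => //; first exact: measurable_mass.
by move=> x _; rewrite lee_fin powR_ge0.
Qed.

(** [powRD_le] integrated with [a = |f|] and [b = |g|]. The coefficient of [g] stays close to 1,
    which the triangle inequality with a fixed constant would not give for [p < 1]. *)
Lemma mass_sub_le (e : R) : 0 < e ->
  exists2 C : R, 0 <= C & forall (f g : Omega -> K) (A : set Omega),
  measurable A -> measK f -> measK g ->
  (mass (fun x => (f x - g x)%R) A <= (1 + e)%:E * mass g A + C%:E * mass f A)%E.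
Proof.
move=> e0; have [C C0 CP] := powRD_le p0 e0; exists C => // f g A mA mf mg.
have e1 : 0 <= 1 + e by lra.
have pos (c : R) h x : 0 <= c -> (0 <= c%:E * (absK (h x) `^ p)%:E)%E.
  by move=> c0; rewrite mule_ge0 ?lee_fin ?powR_ge0.
rewrite /mass -ge0_integralZl_EFin//; last 2 first.
- by move=> x _; rewrite lee_fin powR_ge0.
- exact: measurable_mass.
rewrite -ge0_integralZl_EFin//; last 2 first.
- by move=> x _; rewrite lee_fin powR_ge0.
- exact: measurable_mass.
rewrite -ge0_integralD//; last 4 first.
- by move=> x _; exact: pos.
- by apply: measurable_funeM; exact: measurable_mass.
- by move=> x _; exact: pos.
- by apply: measurable_funeM; exact: measurable_mass.
apply: ge0_le_integral => //.
- by move=> x _; rewrite lee_fin powR_ge0.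
- by apply: (@measurable_mass (fun x => f x - g x)); exact: measKB.
- by apply: emeasurable_funD; apply: measurable_funeM; exact: measurable_mass.
move=> x _; rewrite -!EFinM -EFinD lee_fin.
apply: le_trans (CP _ _ (absK_ge0 (f x)) (absK_ge0 (g x))).
apply: ge0_ler_powR; first exact: ltW.
- by rewrite nnegrE absK_ge0.
- by rewrite nnegrE addr_ge0 ?absK_ge0.
by have := absKB_le (f x) 0 (g x); rewrite (absKBC 0) !subr0.
Qed.

Local Notation S := (Lp_sphere mu p absK measK).

Lemma exists_normalized_indicator (A : set Omega) : measurable A ->
  (0 < mu A)%E -> (mu A < +oo)%E -> exists2 w, S w & forall x, ~ A x -> w x = 0.
Proof.
move=> mA A0 Aoo.
have Afin : mu A \is a fin_num by rewrite ge0_fin_numE.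
have m0 : 0 < fine (mu A) by rewrite fine_gt0// A0.
pose r := (fine (mu A))^-1 `^ p^-1.
have r0 : 0 <= r by exact: powR_ge0.
have wA x : ~ A x -> ofR (r * \1_A x) = 0.
  move=> nAx; rewrite indicE memNset// mulr0; apply: absK_eq0.
  by rewrite absK_ofR normr0.
exists (fun x => ofR (r * \1_A x)) => //.
apply/Lp_sphereE; split; first exact: measK_indic.
have mi := measK_indic r mA.
rewrite (mass_setC mA mi) (_ : mass _ (~` A) = 0%E); last first.
  by apply: mass_eq0 => x; exact: wA.
rewrite adde0 /mass (eq_integral (fun=> (fine (mu A))^-1%:E)); last first.
  move=> x /[!inE] Ax; rewrite absK_ofR indicE mem_set// mulr1 ger0_norm//.
  by rewrite /r -powRrM mulVf ?gt_eqF// powRr1// invr_ge0 ltW.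
by rewrite integral_cst// -{2}(fineK Afin) -EFinM mulVf// gt_eqF.
Qed.

Lemma sum_mass_le n (A : nat -> set Omega) f :
  (forall i, (i < n)%N -> measurable (A i)) ->
  (forall i j, (i < n)%N -> (j < n)%N -> i != j -> A i `&` A j = set0) ->
  S f -> \sum_(i < n) fine (mass f (A i)) <= 1.
Proof.
move=> mA Adis /Lp_sphereE[mf f1].
(* Padding with the empty set makes the family measurable at every index. *)
pose A' i := if (i < n)%N then A i else set0.
have mA' i : measurable (A' i) by rewrite /A'; case: ifP => // /mA.
have le1 : (\sum_(i < n) mass f (A i) <= 1)%E.
  rewrite (eq_bigr (fun i : 'I_n => mass f (A' i))); last first.
    by move=> i _; rewrite /A' ltn_ord.
  rewrite -(big_mkord xpredT (fun i => mass f (A' i))) /mass.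
  rewrite -ge0_integral_bigsetU//.
  - rewrite -f1; apply: ge0_subset_integral => //.
    + by apply: bigsetU_measurable.
    + exact: measurable_mass.
    + by move=> x _; rewrite lee_fin powR_ge0.
  - exact: iota_uniq.
  - apply/trivIsetP => i j; rewrite /= !mem_index_iota !leq0n /= => ni nj ij.
    by rewrite /A' ni nj Adis.
  - exact: measurable_mass.
  - by move=> x _; rewrite lee_fin powR_ge0.
rewrite -lee_fin -sumEFin; apply: le_trans le1.
rewrite le_eqVlt; apply/orP; left; apply/eqP; apply: eq_bigr => i _.
by rewrite fineK//; apply: mass_fin_num; rewrite ?f1 ?ltry//; exact: mA.
Qed.

(* Unification would otherwise unfold the integrals of unequal integrands. *)
Opaque mass.

(** The p-th power of the distance, to which estimates of integrals apply directly. [fine] would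
    send an infinite integral to 0; [mass_sphere_sub_fin] excludes that case on the sphere. *)
Definition distp f g := fine (mass (fun x => f x - g x) setT).

Lemma distp_ge0 f g : 0 <= distp f g.
Proof. by rewrite fine_ge0 ?mass_ge0. Qed.

Lemma distpC f g : distp f g = distp g f.
Proof. by rewrite /distp mass_subC. Qed.

Lemma distp_diag f : distp f f = 0.
Proof.
by rewrite /distp mass_eq0// => x _; rewrite subrr.
Qed.

Lemma lp_distE f g : lp_dist mu p absK f g = distp f g `^ p^-1.
Proof. by rewrite /lp_dist lp_normE. Qed.

Lemma lp_dist_ge0 f g : 0 <= lp_dist mu p absK f g.
Proof. by rewrite lp_distE powR_ge0. Qed.

Lemma lp_distC f g : lp_dist mu p absK f g = lp_dist mu p absK g f.
Proof. by rewrite !lp_distE distpC. Qed.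

Lemma distp_lp f g : distp f g = lp_dist mu p absK f g `^ p.
Proof. by rewrite lp_distE -powRrM mulVf ?gt_eqF// powRr1 ?distp_ge0. Qed.

Lemma lp_dist_lt f g r : 0 < r ->
  (lp_dist mu p absK f g < r) = (distp f g < r `^ p).
Proof.
move=> r0; have pi0 : 0 < p^-1 by rewrite invr_gt0.
apply/idP/idP => h.
  by rewrite distp_lp gt0_ltr_powR// nnegrE ?lp_dist_ge0// ltW.
rewrite -(powRr1 (ltW r0)) -(mulfV (lt0r_neq0 p0)) powRrM lp_distE.
by rewrite gt0_ltr_powR// nnegrE ?distp_ge0 ?powR_ge0.
Qed.

Lemma mass_sphere_sub_fin f g : S f -> S g ->
  mass (fun x => f x - g x) setT \is a fin_num.
Proof.
move=> /Lp_sphereE[mf f1] /Lp_sphereE[mg g1].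
have [C C0 CP] := mass_sub_le (@ltr01 R).
rewrite ge0_fin_numE ?mass_ge0//.
apply: le_lt_trans (CP _ _ _ measurableT mf mg) _.
by rewrite f1 g1 !mule1 -EFinD ltry.
Qed.

(* The substitute, valid for every p > 0, of the triangle inequality. *)
Lemma distp_le (e : R) : 0 < e -> exists2 C : R, 0 <= C & forall f g h,
  S f -> S g -> S h -> distp f h <= (1 + e) * distp g h + C * distp f g.
Proof.
move=> e0; have [C C0 CP] := mass_sub_le e0; exists C => // f g h Sf Sg Sh.
move/Lp_sphereE: (Sf) => [mf _]; move/Lp_sphereE: (Sg) => [mg _].
move/Lp_sphereE: (Sh) => [mh _].
(* The functions compared are [f - g] and [h - g], whose difference is [f - h]. *)
have := CP _ _ _ measurableT (measKB mf mg) (measKB mh mg).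
rewrite (_ : mass (fun x => f x - g x - (h x - g x)) setT =
             mass (fun x => f x - h x) setT); last first.
  by apply: eq_mass => x _; congr absK; ring.
rewrite (distpC g h) /distp.
have := mass_sphere_sub_fin Sf Sg; have := mass_sphere_sub_fin Sf Sh.
have := mass_sphere_sub_fin Sh Sg.
do 3 move/fineK => <-.
by rewrite -!EFinM -EFinD lee_fin.
Qed.

(** Off [A] the difference [f - w] equals [f]. On [A], [mass_sub_le] is used in both directions: for
    the pair [f], [w], and for the pair [f], [f - w], whose difference is [w]. *)
Lemma distp_disjoint_approx (e : R) : 0 < e -> exists2 C : R, 0 <= C & forall A w f,
  measurable A -> S w -> (forall x, ~ A x -> w x = 0) -> S f ->
  `|distp f w - 2| <= e + C * fine (mass f A).
Proof.
move=> e0; have [C C0 CP] := mass_sub_le e0; exists (1 + C); first by rewrite addr_ge0.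
move=> A w f mA Sw wA Sf; have := mass_sphere_sub_fin Sf Sw.
move/Lp_sphereE : (Sw) => [mw w1]; move/Lp_sphereE : (Sf) => [mf f1].
have mfw : measK (fun x => f x - w x) by exact: measKB.
have wE : mass w A = 1%E.
  by rewrite -w1 (mass_setC mA mw) (mass_eq0 wA) adde0.
have fwE : mass (fun x => f x - w x) (~` A) = mass f (~` A).
  by apply: eq_mass => x /wA ->; rewrite subr0.
have ffwE : mass (fun x => f x - (f x - w x)) A = mass w A.
  by apply: eq_mass => x _; rewrite subKr.
have := CP _ _ _ mA mf mw; have := CP _ _ _ mA mf mfw.
rewrite /distp (mass_setC mA mfw) fwE ffwE wE.
rewrite fin_numD => + + /andP[fc fb].
have := f1; rewrite (mass_setC mA mf) => ab.
have fa : mass f A \is a fin_num by apply: mass_fin_num; rewrite ?f1 ?ltry.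
have [[a Ea] [b Eb]] : (exists a, mass f A = a%:E) /\ (exists b, mass f (~` A) = b%:E).
  by rewrite -(fineK fa) -(fineK fb); split; eexists.
have [c Ec] : exists c, mass (fun x => f x - w x) A = c%:E.
  by rewrite -(fineK fc); eexists.
have a0 : 0 <= a by rewrite -lee_fin -Ea mass_ge0.
have c0 : 0 <= c by rewrite -lee_fin -Ec mass_ge0.
rewrite Ea Eb Ec /= -!EFinM -!EFinD !lee_fin => h1 h2.
move: ab; rewrite Ea Eb => -[ab].
exact: dist_two_of_parts (ltW e0) C0 ab a0 c0 h1 h2.
Qed.

(** * Nearly constant averages of distances *)

Lemma Udisc_approx (e : R) : 0 < e -> Lp_infinite_dimensional mu p absK measK ->
  exists n (w : 'I_n -> Omega -> K), [/\ (0 < n)%N, forall j, S (w j) &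
    forall f, S f -> `|Udisc mu p absK w f - 2 `^ p^-1| <= e].
Proof.
move=> e0 inf; have pi0 : 0 < p^-1 by rewrite invr_gt0.
(* This crude bound only confines [distp f w] to the interval from 0 to [3 + C1], on which the root
   is then compared with its value at 2. *)
have [C1 C10 C1P] := distp_disjoint_approx (@ltr01 R).
have e2 : 0 < e / 2 by rewrite divr_gt0.
have [L L0 LP] := powR_Lipschitz_approx (3 + C1) pi0 (@ltr0n R 2) e2.
(* [L] is fixed first, so that the error [e / (4 (L + 1))] costs at most [e / 4] after
   multiplication by [L]; the constant [C] and then [n] depend on it. *)
have e4 : 0 < e / (4 * (L + 1)).
  by rewrite divr_gt0// mulr_gt0// ltr_wpDl.
have [C C0 CP] := distp_disjoint_approx e4.
(* The masses of [f] on the disjoint sets add up to at most 1, so their average contributes at most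
   [L C / n]. *)
have [n nP] : exists n, (0 < n)%N /\ L * C / n%:R <= e / 4.
  exists (Num.truncn (L * C / (e / 4))).+1; split => //.
  rewrite ler_pdivrMr ?ltr0n// [X in _ <= X]mulrC -ler_pdivrMr ?divr_gt0//.
  apply: ltW; exact: truncnS_gt.
case: nP => n0 nP.
have [A [AP Adis]] := exists_disjoint_sets n inf.
have /choice[w wP] (j : 'I_n) : exists w, S w /\ forall x, ~ A j x -> w x = 0.
  have [mA A0 Aoo] := AP _ (ltn_ord j).
  by have [w ? ?] := exists_normalized_indicator mA A0 Aoo; exists w.
exists n, w; split => // [j|f Sf]; first by have [] := wP j.
have mA (j : 'I_n) : measurable (A j) by have [] := AP _ (ltn_ord j).
pose a (j : 'I_n) := fine (mass f (A j)).
have a0 j : 0 <= a j by rewrite fine_ge0 ?mass_ge0.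
have suma : \sum_(j < n) a j <= 1.
  by apply: sum_mass_le => // i ni; have [] := AP _ ni.
have a1 j : a j <= 1.
  by apply: le_trans suma; rewrite (bigD1 j)//= lerDl sumr_ge0.
have dj j : `|lp_dist mu p absK f (w j) - 2 `^ p^-1| <= e / 2 + e / 4 + L * C * a j.
  have [Sw wA] := wP j; rewrite lp_distE.
  have := C1P _ _ _ (mA j) Sw wA Sf; have := CP _ _ _ (mA j) Sw wA Sf.
  rewrite -/(a j) => h h1.
  have C1a : C1 * a j <= C1 by rewrite ler_piMr.
  have D3 : 0 <= distp f (w j) <= 3 + C1.
    rewrite distp_ge0 /=; move: h1; rewrite ler_norml => /andP[_]; lra.
  apply: le_trans (LP _ D3) _; rewrite -addrA lerD2l.
  apply: le_trans (ler_wpM2l L0 h) _; rewrite mulrDr (mulrA L C) lerD2r.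
  rewrite mulrA ler_pdivrMr ?mulr_gt0// ?ltr_wpDl//; nra.
have n0' : 0 < n%:R :> R by rewrite ltr0n.
have ni0 : 0 <= n%:R^-1 :> R by rewrite invr_ge0 ltW.
rewrite /Udisc.
rewrite (_ : _ - _ = n%:R^-1 * \sum_(j < n) (lp_dist mu p absK f (w j) - 2 `^ p^-1)); last first.
  rewrite sumrB mulrBr sumr_const card_ord; congr (_ - _).
  by rewrite -(mulr_natl (2 `^ p^-1) n) mulKf// gt_eqF.
rewrite normrM [X in X * _]ger0_norm//.
apply: (@le_trans _ _ (n%:R^-1 * \sum_(j < n) (e / 2 + e / 4 + L * C * a j))).
  rewrite ler_wpM2l//; apply: le_trans (ler_norm_sum _ _ _) _.
  by apply: ler_sum => j _; exact: dj.
rewrite big_split/= sumr_const card_ord -mulr_sumr mulrDr.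
rewrite -(mulr_natl (e / 2 + e / 4) n) mulKf ?gt_eqF//.
have : n%:R^-1 * (L * C * \sum_(j < n) a j) <= e / 4.
  apply: le_trans nP; rewrite mulrC ler_wpM2r//.
  by rewrite ler_piMr ?mulr_ge0.
lra.
Qed.

(** * Borel sets and regular measures on the sphere *)

Local Notation sopen := (sphere_open mu p absK measK).
Local Notation BorelS := (g_sigma_algebraType sopen).
Local Notation dist := (lp_dist mu p absK).

Lemma sphere_openT : sopen S.
Proof. by split=> // f _; exists 1 => // g []. Qed.

Lemma sphere_openI U V : sopen U -> sopen V -> sopen (U `&` V).
Proof.
move=> [US Uo] [VS Vo]; split=> [f [/US]//|f [/Uo[r r0 fr] /Vo[s s0 fs]]].
exists (Num.min r s); first by rewrite lt_min r0.
by move=> g [Sg]; rewrite lt_min => /andP[gr gs]; split; [exact: fr|exact: fs].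
Qed.

(** The factor [S] keeps the empty intersection inside the sphere. *)
Lemma sphere_open_bigcap n (U : 'I_n -> set (Omega -> K)) :
  (forall i, sopen (U i)) -> sopen (S `&` \bigcap_i U i).
Proof.
move=> Uo; rewrite (_ : \bigcap_i U i = \big[setI/setT]_(i <- enum 'I_n) U i).
  elim: (enum _) => [|i s IH].
    by rewrite big_nil setIT; exact: sphere_openT.
  by rewrite big_cons setICA; exact: sphere_openI.
rewrite -bigcap_seq; congr bigcap.
by apply/seteqP; split => // i _ /=; rewrite mem_enum.
Qed.

(** For [p < 1] the triangle inequality may fail for [dist]. The gap [t] between [r ^ p] and
    [distp w g] is shared out instead between the two errors of [distp_le]. *)
Lemma sphere_open_lt w r : S w -> sopen [set g | S g /\ dist w g < r].
Proof.
move=> Sw; split=> [g []//|g [Sg] gr].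
have r0 : 0 < r by exact: le_lt_trans (lp_dist_ge0 _ _) gr.
have := gr; rewrite lp_dist_lt// => Dr.
pose m := distp w g; pose t := r `^ p - m.
have m0 : 0 <= m by exact: distp_ge0.
have t0 : 0 < t by rewrite subr_gt0.
have e0 : 0 < t / (2 * (m + 1)) by rewrite divr_gt0// mulr_gt0// ltr_wpDl.
have [C C0 CP] := distp_le e0.
have s0 : 0 < t / (2 * (C + 1)) by rewrite divr_gt0// mulr_gt0// ltr_wpDl.
exists ((t / (2 * (C + 1))) `^ p^-1); first by rewrite powR_gt0.
move=> h [Sh]; rewrite lp_dist_lt ?powR_gt0// -powRrM mulVf ?gt_eqF//.
rewrite powRr1 ?(ltW s0)// => gh; split => //.
rewrite (lp_dist_lt w h r0) (distpC w h); apply: le_lt_trans (CP _ _ _ Sh Sg Sw) _.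
rewrite (distpC g w) -/m (distpC h g).
rewrite (_ : r `^ p = m + t); last by rewrite /t addrC subrK.
exact: perturbation_lt.
Qed.

(** The complement of the a.e. class of [w], needed for outer regularity. If [h] were at distance 0
    from [w], then [distp w g] would be at most twice [distp h g], hence smaller than itself. *)
Lemma sphere_open_gt0 w : S w -> sopen [set g | S g /\ 0 < dist w g].
Proof.
move=> Sw; split=> [g []//|g [Sg] g0].
have m0 : 0 < distp w g by rewrite distp_lp powR_gt0.
have [C C0 CP] := distp_le (@ltr01 R).
exists ((distp w g / 2) `^ p^-1); first by rewrite powR_gt0 ?divr_gt0.
move=> h [Sh]; rewrite lp_dist_lt ?powR_gt0 ?divr_gt0// -powRrM mulVf ?gt_eqF//.
rewrite powRr1 ?divr_ge0 ?(ltW m0)// => gh; split => //.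
rewrite lt_neqAle lp_dist_ge0 andbT eq_sym; apply/eqP => wh.
have := CP _ _ _ Sw Sh Sg; rewrite (distp_lp w h) wh powR0 ?gt_eqF// mulr0 addr0.
by rewrite (distpC h); move: m0 gh; move: (distp w g) (distp g h) => *; lra.
Qed.

Lemma measurable_sphere_open (U : set (Omega -> K)) :
  sopen U -> measurable (U : set BorelS).
Proof. by move=> Uo; exact: sub_sigma_algebra. Qed.

Lemma measurable_sphere : measurable (S : set BorelS).
Proof. by apply: measurable_sphere_open; exact: sphere_openT. Qed.

Lemma measurable_dist w : S w ->
  measurable_fun (S : set BorelS) (dist w : BorelS -> R).
Proof.
move=> Sw mS; apply: (measurability _ (RGenInftyO.measurableE R)) => //.
move=> _ [_ [x ->] <-].
rewrite (_ : _ `&` _ = [set g | S g /\ dist w g < x]).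
  by apply: measurable_sphere_open; exact: sphere_open_lt.
by apply/seteqP; split => g /=; rewrite in_itv.
Qed.

(** Points of the sphere are functions, not classes. Open sets do not separate functions at distance
    0, and this property passes to complements, by symmetry, and to countable unions. *)
Lemma measurable_sphere_saturated (B : set BorelS) f g : measurable B ->
  S f -> S g -> dist f g = 0 -> B f -> B g.
Proof.
pose P := [set B : set (Omega -> K) |
  forall f g, S f -> S g -> dist f g = 0 -> B f -> B g].
move=> mB; suff : P B by apply.
apply: smallest_sub mB; first split.
- by [].
- by move=> A PA f' g' Sf Sg fg [_ nAf]; split => // Ag; apply: nAf;
    apply: PA Ag; rewrite // lp_distC.
- by move=> A PA f' g' Sf Sg fg [k _ Ak]; exists k => //; exact: PA Ak.
move=> U [US Uo] f' g' Sf Sg fg /Uo[r r0]; apply; split => //.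
by rewrite fg.
Qed.

Lemma finite_sphere_compact n (w : 'I_n -> Omega -> K) C :
  C `<=` S -> C `<=` range w -> sphere_compact mu p absK measK C.
Proof.
move=> CS Cw; split => // I U Uo CU.
(* [None] serves the points outside [C], since [I] may be empty. *)
have /choice[h hP] (j : 'I_n) :
    exists o, C (w j) -> exists2 i, o = Some i & U i (w j).
  have [/CU[i _ Ui]|nC] := pselect (C (w j)); last by exists None.
  by exists (Some i) => _; exists i.
exists (Some @^-1` range h); split.
  by apply: finite_preimage; [move=> x y _ _ []|exact: finite_image].
move=> g Cg; have [j _ wj] := Cw _ Cg; rewrite -wj in Cg *.
by have [i hi Ui] := hP _ Cg; exists i => //; exists j.
Qed.

(** The finite set of those [w j] that lie in [B] is compact and carries the mass of [B]. From
    outside, [B] is approximated by the sphere without the a.e. classes of the finitely many [w j]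
    not in [B]. *)
Lemma empirical_regular n (w : 'I_n.+1 -> BorelS) : (forall j, S (w j)) ->
  regular_on_sphere (empirical w : probability BorelS R).
Proof.
move=> Sw; split.
  rewrite [LHS]empiricalE big1 ?mulr0// => j _.
  by rewrite indicE memNset//; apply; exact: Sw.
move=> B mB BS; split; apply/eqP; rewrite eq_le; apply/andP; split.
- pose C : set (Omega -> K) := B `&` range w.
  apply: (@le_trans _ _ (empirical w C)).
    by apply: empirical_le => j Bw; split.
  apply: ereal_sup_ubound; exists C => //; split; last by move=> g [].
  by apply: (@finite_sphere_compact _ w) => g [] // /BS.
- apply: ge_ereal_sup => _ [C [_ CB] <-].
  by apply: empirical_le => j; exact: CB.
- apply: le_ereal_inf_tmp => _ [U [_ BU] <-].
  by apply: empirical_le => j; exact: BU.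
pose V (j : 'I_n.+1) : set (Omega -> K) :=
  if `[< B (w j) >] then S else [set g | S g /\ 0 < dist (w j) g].
have Vo j : sopen (V j).
  by rewrite /V; case: asboolP => _; [exact: sphere_openT|exact: sphere_open_gt0].
apply: (@le_trans _ _ (empirical w (S `&` \bigcap_i V i))).
  apply: ereal_inf_lbound; exists (S `&` \bigcap_i V i) => //; split.
    exact: sphere_open_bigcap.
  move=> g Bg; split; first exact: BS.
  move=> j _; rewrite /V; case: asboolP => [_|nB]; first exact: BS.
  split; first exact: BS.
  (* A point of [B] at distance 0 from [w j] would force [w j] into [B], by saturation. *)
  rewrite lt_neqAle lp_dist_ge0 andbT eq_sym; apply/eqP => d0; apply: nB.
  rewrite lp_distC in d0.
  exact: (measurable_sphere_saturated mB (BS _ Bg) (Sw j) d0 Bg).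
apply: empirical_le => j [_ /(_ j I)]; rewrite /V; case: asboolP => // _ [_].
by rewrite lp_distE distp_diag powR0 ?ltxx// invr_neq0// gt_eqF.
Qed.

(** * The average set and the rendezvous set *)

Lemma Upot_empirical n (w : 'I_n.+1 -> BorelS) f : (forall j, S (w j)) -> S f ->
  Upot (empirical w : probability BorelS R) f = (Udisc mu p absK w f)%:E.
Proof.
move=> Sw Sf; rewrite /Upot integral_empirical//.
- exact: measurable_sphere.
- exact: measurable_dist.
- by move=> g _; exact: lp_dist_ge0.
Qed.

Lemma average_set_sub_rendezvous_set :
  average_set mu p absK measK `<=` rendezvous_set mu p absK measK.
Proof.
move=> r rA [//|n] w _ Sw.
have := rA _ (empirical_regular Sw).
by rewrite (eq_imagel (fun f => Upot_empirical Sw)).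
Qed.

(** Every rendezvous value lies between the infimum and the supremum of a [Udisc w] that stays
    within [e] of [2^(1/p)]. *)
Lemma rendezvous_set_sub : Lp_infinite_dimensional mu p absK measK ->
  rendezvous_set mu p absK measK `<=` [set 2 `^ p^-1].
Proof.
move=> inf r rR; apply/eqP; rewrite -subr_eq0 -normr_le0.
apply/ler_addgt0Pr => e e0; rewrite add0r.
have [n [w [n0 Sw wP]]] := Udisc_approx e0 inf.
have /andP[h1 h2] := rR _ w n0 Sw.
rewrite ler_distl; apply/andP; split.
  rewrite -lee_fin; apply: le_trans h1; apply: le_ereal_inf_tmp => _ [f Sf <-].
  by rewrite lee_fin; have := wP _ Sf; rewrite ler_distl => /andP[].
rewrite -lee_fin; apply: (le_trans h2); apply: ge_ereal_sup => _ [f Sf <-].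
by rewrite lee_fin; have := wP _ Sf; rewrite ler_distl => /andP[].
Qed.

(** Sum and integral are exchanged, and symmetry of the distance turns the integrand into a multiple
    of [Udisc w] at the integration variable. *)
Lemma sum_Upot (nu : probability BorelS R) n (w : 'I_n -> Omega -> K) :
  (forall j, S (w j)) -> (0 < n)%N ->
  (\sum_j Upot nu (w j) =
   \int[nu]_(g in (S : set BorelS)) (n%:R * Udisc mu p absK w g)%:E)%E.
Proof.
move=> Sw n0; rewrite /Upot -ge0_integral_sum; last 3 first.
- exact: measurable_sphere.
- by move=> j; apply/measurable_EFinP; exact: measurable_dist.
- by move=> j g _; rewrite lee_fin lp_dist_ge0.
apply: eq_integral => g _; rewrite sumEFin /Udisc mulVKf ?pnatr_eq0 -?lt0n//.
by congr EFin; apply: eq_bigr => j _; exact: lp_distC.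
Qed.

(* Averaging the potential of [nu] over the points of a nearly constant
   [Udisc w] makes [nu] drop out. *)
Lemma mem_average_set : Lp_infinite_dimensional mu p absK measK ->
  average_set mu p absK measK (2 `^ p^-1).
Proof.
move=> inf nu [nuSC _].
pose c : R := 2 `^ p^-1.
have c0 : 0 < c by rewrite powR_gt0.
have nuS : nu (S : set BorelS) = 1%E.
  rewrite -[S]setCK probability_setC; last first.
    by apply: measurableC; exact: measurable_sphere.
  by rewrite nuSC sube0.
have int_cst (x : R) : (\int[nu]_(g in (S : set BorelS)) x%:E = x%:E)%E.
  transitivity (x%:E * nu (S : set BorelS))%E; last by rewrite nuS mule1.
  exact: (integral_cst nu measurable_sphere x%:E).
have mU n (w : 'I_n -> Omega -> K) : (forall j, S (w j)) ->
    measurable_fun (S : set BorelS) (fun g => (n%:R * Udisc mu p absK w g)%:E).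
  move=> Sw; apply/measurable_EFinP/measurable_funM => //.
  apply: measurable_funM => //; apply: measurable_sum => j.
  rewrite (_ : (fun g => _) = dist (w j)); first exact: measurable_dist.
  by apply/funext => g; rewrite lp_distC.
(* The restriction [e < c] keeps [c - e], and with it [Udisc w], nonnegative, as [ge0_le_integral]
   demands. *)
have key e : 0 < e -> e < c ->
    (ereal_inf [set Upot nu f | f in S] <= (c + e)%:E)%E /\
    ((c - e)%:E <= ereal_sup [set Upot nu f | f in S])%E.
  move=> e0 ec; have [n [w [n0 Sw wP]]] := Udisc_approx e0 inf.
  have n0' : 0 < n%:R :> R by rewrite ltr0n.
  split.
    apply: (mean_le n0) => [j|].
      by apply: ereal_inf_lbound; exists (w j).
    rewrite sum_Upot// -(int_cst (n%:R * (c + e))).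
    apply: ge0_le_integral; [exact: measurable_sphere| |exact: mU|
      exact: measurable_cst|].
      move=> g Sg; rewrite lee_fin mulr_ge0// ?ler0n//.
      by have := wP _ Sg; rewrite ler_distl -/c => /andP[+ _]; lra.
    move=> g Sg; rewrite lee_fin ler_pM2l//.
    by have := wP _ Sg; rewrite ler_distl => /andP[].
  apply: (mean_ge n0) => [j|].
    by apply: ereal_sup_ubound; exists (w j).
  rewrite sum_Upot// -(int_cst (n%:R * (c - e))).
  apply: ge0_le_integral; [exact: measurable_sphere| |exact: measurable_cst|
    exact: mU|].
    by move=> g Sg; rewrite lee_fin mulr_ge0// ?ler0n// subr_ge0 ltW.
  move=> g Sg; rewrite lee_fin ler_pM2l//.
  by have := wP _ Sg; rewrite ler_distl => /andP[].
have small e : 0 < e -> exists2 e', 0 < e' & e' < c /\ e' <= e.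
  move=> e0; exists (Num.min e (c / 2)); first by rewrite lt_min e0 divr_gt0.
  split; last by rewrite ge_min lexx.
  by rewrite gt_min; apply/orP; right; lra.
rewrite -/c; apply/andP; split; apply/lee_addgt0Pr => e /small[e' e'0 [e'c e'e]].
  have [+ _] := key _ e'0 e'c; move/le_trans; apply.
  by rewrite -EFinD lee_fin lerD2l.
have [_] := key _ e'0 e'c; rewrite -leeBlDr// => h.
by apply: le_trans h; rewrite -EFinB lee_fin lerD2l lerN2.
Qed.

Lemma average_rendezvous_eq : Lp_infinite_dimensional mu p absK measK ->
  average_set mu p absK measK = [set 2 `^ p^-1] /\
  rendezvous_set mu p absK measK = [set 2 `^ p^-1].
Proof.
move=> inf.
have AR := average_set_sub_rendezvous_set; have Rc := rendezvous_set_sub inf.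
have cA := mem_average_set inf.
by split; apply/seteqP; split => [|_ ->]; [exact: subset_trans Rc|exact: cA|exact: Rc|exact: AR].
Qed.

End scalars.

(** * The real and the complex field *)

Lemma planar_real (R : realType) (d : measure_display)
    (Omega : measurableType d) :
  planar (@absR R) (@measR R d Omega) id (fun=> 0) id.
Proof.
split => //.
- by move=> _ _; rewrite subr0.
- by move=> x; rewrite expr0n addr0 sqrtr_sqr.
- by move=> f; split => [mf|[]//]; split => //; exact: measurable_cst.
Qed.

Lemma planar_complex (R : realType) (d : measure_display)
    (Omega : measurableType d) :
  planar (@absC R) (@measC R d Omega)
    (@complex.Re R) (@complex.Im R) (fun r => (r%:C)%C).
Proof.
split => //.
- by move=> [a b] [u v].
- by move=> [a b] [u v].
- by move=> [a b] [u v] /= -> ->.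
Qed.

Unset Implicit Arguments.

Theorem theorem4p1 (R : realType) (d : measure_display)
  (Omega : measurableType d) (mu : {measure set Omega -> \bar R}) (p : R) :
  0 < p ->
  (* real scalars: L_p(Omega, mu; R) *)
  (Lp_infinite_dimensional mu p (@absR R) (@measR R d Omega) ->
     average_set mu p (@absR R) (@measR R d Omega) = [set 2 `^ p^-1] /\
     rendezvous_set mu p (@absR R) (@measR R d Omega) = [set 2 `^ p^-1]) /\
  (* complex scalars: L_p(Omega, mu; C) *)
  (Lp_infinite_dimensional mu p (@absC R) (@measC R d Omega) ->
     average_set mu p (@absC R) (@measC R d Omega) = [set 2 `^ p^-1] /\
     rendezvous_set mu p (@absC R) (@measC R d Omega) = [set 2 `^ p^-1]).
Proof.
move=> p0; split.
  exact: (average_rendezvous_eq (planar_real R Omega) p0).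
exact: (average_rendezvous_eq (planar_complex R Omega) p0).
Qed.
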